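(* Let $(X,d)$ be a compact metric space and let $T_1,\dots,T_k\colon X\to X$ ($k\ge2$) be continuous maps such that, for $\mathrm{IFS}(T_1,\dots,T_k)$ with target set $A_{\mathrm t}$, the set $\overline{A_{\mathrm t}}$ is a stable fixed point of the Barnsley-Hutchinson operator. Then for every $x\in X$ and every disjunctive sequence $\xi\in\Sigma_k^+$ we have $$\overline{A_{\mathrm t}}=\bigcap_{\ell\ge0}\overline{\{x_{n,\xi}: n\ge\ell\}},\qquad\text{where } x_{n,\xi}=T_{\xi_n}\circ\cdots\circ T_{\xi_0}(x).$$ In particular, $$\lim_{\ell\to\infty}\{x_{n,\xi}: n\ge\ell\}=\overline{A_{\mathrm t}},$$ where the limit is considered in the Hausdorff distance.
   Context: The Barnsley-Hutchinson operator of $\mathrm{IFS}(T_1,\dots,T_k)$ is $\mathcal B(A)=\bigcup_{i=1}^k T_i(A)$ for $A\subset X$. A fixed point of $\mathcal B$ means a non-empty compact set $K\subset X$ with $\mathcal B(K)=K$. A fixed point $A$ of $\mathcal B$ is stable if for every open neighbourhood $V$ of $A$ there is an open neighbourhood $V_0$ of $A$ such that $\mathcal B^n(V_0)\subset V$ for every $n\ge0$. $\Sigma_k^+=\{1,\dots,k\}^{\mathbb N}$ with the product topology and left shift $\sigma(\xi)_n=\xi_{n+1}$. A sequence $\xi\in\Sigma_k^+$ is disjunctive if its orbit $\{\sigma^n(\xi): n\ge0\}$ is dense in $\Sigma_k^+$. The set of weakly hyperbolic sequences is $S_{\mathrm t}=\{\xi\in\Sigma_k^+ : \lim_{n\to\infty}\mathrm{diam}(T_{\xi_0}\circ\cdots\circ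 T_{\xi_n}(X))=0\}$. The coding map $\pi\colon S_{\mathrm t}\to X$ is $\pi(\xi)=\lim_{n\to\infty}T_{\xi_0}\circ\cdots\circ T_{\xi_n}(p)$, which does not depend on $p\in X$. The target set is $A_{\mathrm t}=\pi(S_{\mathrm t})$. The Hausdorff distance between subsets $A,B$ of $X$ (not necessarily closed, so a pseudo-metric) is $d_H(A,B)=\max\{h_s(A,B),h_s(B,A)\}$, where $h_s(A,B)=\sup_{a\in A}\inf_{b\in B}d(a,b)$. *)

(* Defs.v *)
From HB Require Import structures.
From mathcomp Require Import all_boot all_order all_algebra.
From mathcomp Require Import all_classical all_reals all_analysis.

Set Implicit Arguments.
Unset Strict Implicit.
Unset Printing Implicit Defensive.

Import Order.TTheory GRing.Theory Num.Theory.

Local Open Scope classical_set_scope.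
Local Open Scope ring_scope.

Section metric_notions.
Context {R : realType} {X : metricType R}.
Implicit Types A B : set X.

(* Suprema and infima are taken in \bar R, so that no boundedness is assumed. *)
Definition diam A : \bar R :=
  ereal_sup [set (mdist a.1 a.2)%:E | a in A `*` A].

Definition hausdorff_excess A B : \bar R :=
  ereal_sup [set ereal_inf [set (mdist a b)%:E | b in B] | a in A].

Definition hausdorff_dist A B : \bar R :=
  Order.max (hausdorff_excess A B) (hausdorff_excess B A).

End metric_notions.

Section symbolic_space.

(* The k symbols 1, ..., k are represented by 'I_k = {0, ..., k-1}. *)
Definition Sigma (k : nat) : Type :=
  prod_topology (fun _ : nat => discrete_topology 'I_k).

Definition left_shift (k : nat) (xi : Sigma k) : Sigma k := fun n => xi n.+1.

Definition disjunctive (k : nat) (xi : Sigma k) : Prop :=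
  dense [set iter n (@left_shift k) xi | n in [set: nat]].

End symbolic_space.

Section ifs.
Context {R : realType} {X : metricType R} {k : nat}.
Variable T : 'I_k -> X -> X.
Implicit Types (A K V : set X) (xi : Sigma k).

Definition barnsley_hutchinson A : set X := \bigcup_i (T i @` A).

Definition BH_fixed_point K : Prop :=
  [/\ K !=set0, compact K & barnsley_hutchinson K = K].

Definition stable_BH_fixed_point A : Prop :=
  BH_fixed_point A /\
  forall V, open V -> A `<=` V ->
    exists V0, [/\ open V0, A `<=` V0 &
      forall n : nat, iter n barnsley_hutchinson V0 `<=` V].

(* T_(xi 0) \o ... \o T_(xi n) *)
Fixpoint backward_comp xi (n : nat) : X -> X :=
  if n is m.+1 then backward_comp xi m \o T (xi n) else T (xi 0%N).

(* T_(xi n) \o ... \o T_(xi 0) *)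
Fixpoint forward_comp xi (n : nat) : X -> X :=
  if n is m.+1 then T (xi n) \o forward_comp xi m else T (xi 0%N).

Definition weakly_hyperbolic : set (Sigma k) :=
  [set xi | diam (backward_comp xi n @` [set: X]) @[n --> \oo] --> 0%E].

(* The graph of the coding map pi on weakly_hyperbolic; a metricType need not
   be pointed, so lim is not available as a function. See coding_ex_unique. *)
Definition coding xi (y : X) : Prop :=
  forall p : X, backward_comp xi n p @[n --> \oo] --> y.

Lemma coding_ex_unique xi (x0 : X) : compact [set: X] ->
  weakly_hyperbolic xi -> exists! y, coding xi y.
Proof.
move=> cX hxi.
have small e : 0 < e -> exists N, forall n m p q, (N <= n)%N -> (N <= m)%N ->
    ball (backward_comp xi n p) e (backward_comp xi m q).
  move=> e0.
  have : nbhs (0 : \bar R)%E [set z | (z < e%:E)%E].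
    by apply: open_nbhs_nbhs; split; [exact: open_ereal_lt_ereal|rewrite /= lte_fin].
  move=> /hxi[N _ /(_ N (leqnn N))]; rewrite /= => dN; exists N.
  have bE n p : (N <= n)%N -> exists q, backward_comp xi n p = backward_comp xi N q.
    move=> /subnK <-; elim: (n - N)%N p => [|d IH] p; first by exists p.
    by rewrite addSn /=; exact: IH.
  move=> n m p q /(bE _ p)[p' ->] /(bE _ q)[q' ->].
  rewrite ballEmdist /= -lte_fin; apply: (le_lt_trans _ dN).
  apply: ereal_sup_ubound; exists (backward_comp xi N p', backward_comp xi N q') => //.
have [y [_ cy]] := cX _ (fmap_proper_filter (fun n => backward_comp xi n x0) eventually_filter) filterT.
exists y; split.
  move=> p; apply/cvg_ballP => e e0.
  have e20 : 0 < e / 2 by rewrite divr_gt0.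
  have [N hN] := small _ e20.
  have [_ [[n Nn <-]]] := cy [set backward_comp xi n x0 | n in [set n | (N <= n)%N]] (ball y (e / 2))
    ltac:(by exists N => // n Nn; exists n) (nbhsx_ballx _ _ e20).
  move=> yn; exists N => // m Nm /=.
  by rewrite [e]splitr; apply: ball_triangle yn _; exact: hN.
move=> z hz.
apply: (@metric_hausdorff _ X) => A B Ay Bz.
have [N _ hB] := hz x0 _ Bz.
have [a [[n Nn <-] An]] := cy [set backward_comp xi n x0 | n in [set n | (N <= n)%N]] A
  ltac:(by exists N => // n Nn; exists n) Ay.
by exists (backward_comp xi n x0); split => //; exact: hB.
Qed.

Definition target_set : set X :=
  [set y | exists2 xi, weakly_hyperbolic xi & coding xi y].

End ifs.

(* Main.v *)
Require Import Defs.
From mathcomp Require Import all_boot all_order all_algebra.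
From mathcomp Require Import all_classical all_reals all_analysis.

(** Every point [a] of the target set is a nested intersection of the images
    [T_(eta 0) \o ... \o T_(eta n) (X)], whose diameters vanish; so a single
    finite word [eta 0 ... eta n] sends the whole space into any prescribed
    neighbourhood of [a].  A disjunctive driving sequence contains every finite
    word arbitrarily late, in particular the reversed word [eta n ... eta 0];
    and right after reading it a forward orbit is near [a], whatever its
    earlier history ([disjunctive_orbit_visits_target]).

    This gives both inclusions.  All late tails of the orbit accumulate at every
    target point, hence at every point of the closure [K] of the target set.
    Conversely, given an open [V] containing [K], stability provides an open
    [V0] containing [K] whose iterates under the Barnsley-Hutchinson operator
    stay in [V]; one visit to [V0] traps the rest of the orbit in [V]
    ([stable_traps_disjunctive_orbit]).  Accumulation at [K] and trapping in the
    neighbourhoods of [K] say that the tails have [K] as upper limit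
    ([bigcap_closure_trapped]) and that they converge to [K] in the Hausdorff
    distance ([hausdorff_dist_cvg0]). *)

Set Implicit Arguments.
Unset Strict Implicit.

Import Order.TTheory GRing.Theory Num.Theory.

Local Open Scope classical_set_scope.
Local Open Scope ring_scope.

Lemma open_prefix (k : nat) (w : Sigma k) (N : nat) :
  open [set z : Sigma k | forall i, (i < N)%N -> z i = w i].
Proof.
elim: N => [|N IH].
  rewrite (_ : [set _ | _] = setT); first exact: openT.
  by apply/seteqP; split.
rewrite (_ : [set _ | _] = [set z : Sigma k | forall i, (i < N)%N -> z i = w i]
    `&` proj N @^-1` [set w N]).
  apply: openI => //; apply: open_comp; last exact: discrete_open.
  by move=> z _; exact: proj_continuous.
apply/seteqP; split => z /=.
  by move=> h; split => [i iN|]; [apply: h; exact: ltnW|exact: h].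
move=> [h hN] i; rewrite ltnS leq_eqVlt => /predU1P[->|]; first exact: hN.
exact: h.
Qed.

Lemma iter_left_shiftE (k : nat) (xi : Sigma k) (n i : nat) :
  iter n (@left_shift k) xi i = xi (n + i)%N.
Proof. by elim: n i => // n IH i; rewrite iterS /left_shift IH addnS addSn. Qed.

(** Density only yields one occurrence of a word.  Late occurrences come from
    occurrences of longer words, padded in front with [l] arbitrary letters. *)
Lemma disjunctive_word_late (k : nat) (xi w : Sigma k) (l N : nat) :
  disjunctive xi ->
  exists2 s, (l <= s)%N & forall i, (i < N)%N -> xi (s + i)%N = w i.
Proof.
move=> hxi; pose u : Sigma k := fun i => w (i - l)%N.
have [|z [/= hu [n _ ns]]] := hxi _ _ (@open_prefix k u (l + N)); first by exists u.
exists (n + l)%N; first exact: leq_addl.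
move=> i iN; move: (hu (l + i)%N); rewrite ltn_add2l => /(_ iN).
by rewrite -ns iter_left_shiftE addnA /u addKn.
Qed.

Section orbits.
Context {R : realType} {X : metricType R} {k : nat}.
Variable T : 'I_k -> X -> X.
Implicit Types (xi eta : Sigma k) (V K : set X).

Lemma forward_comp_reversed_word xi eta (n s : nat) (x : X) :
  (forall j, (j <= n)%N -> xi (s.+1 + j)%N = eta (n - j)%N) ->
  forward_comp T xi (s.+1 + n) x = backward_comp T eta n (forward_comp T xi s x).
Proof.
elim: n s => [|n IH] s h.
  by rewrite addn0 /= -[s.+1]addn0 h.
rewrite addnS -addSn IH => [|j jn]; first by rewrite /= -[s.+1]addn0 h // subn0.
by rewrite addSnnS h.
Qed.

Lemma disjunctive_forward_backward xi eta (n l : nat) : disjunctive xi ->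
  exists2 m, (l <= m)%N &
    forall x, exists p, forward_comp T xi m x = backward_comp T eta n p.
Proof.
move=> hxi; have [[//|s] ls hs] :=
  @disjunctive_word_late _ _ (fun i => eta (n - i)%N) l.+1 n.+1 hxi.
exists (s.+1 + n)%N => [|x]; first by rewrite (leq_trans (ltnW ls)) ?leq_addr.
by exists (forward_comp T xi s x); exact: forward_comp_reversed_word.
Qed.

Lemma coding_image_sub_nbhs eta (y : X) V :
  weakly_hyperbolic T eta -> coding T eta y -> nbhs y V ->
  exists n, forall p, V (backward_comp T eta n p).
Proof.
move=> hyp cod /nbhs_ballP[e /= e0 eV].
have e20 : 0 < e / 2 by rewrite divr_gt0.
have small : \forall n \near \oo,
    (diam (backward_comp T eta n @` [set: X]) < (e / 2)%:E)%E.
  have /hyp : nbhs (0 : \bar R)%E [set z | (z < (e / 2)%:E)%E].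
    by apply: open_nbhs_nbhs; split; [exact: open_ereal_lt_ereal|rewrite /= lte_fin].
  exact.
have close : \forall n \near \oo, ball y (e / 2) (backward_comp T eta n y).
  by move/cvg_ballP: (cod y); apply.
have [n [dn yn]] := filter_ex (filterI small close).
exists n => p; apply: eV; rewrite [e]splitr; apply: ball_triangle yn _.
rewrite ballEmdist /= -lte_fin; apply: le_lt_trans dn; apply: ereal_sup_ubound.
by exists (backward_comp T eta n y, backward_comp T eta n p).
Qed.

(** The index [m] can be chosen before the starting point [x], since the
    reversed coding word sends all of [X] near [a]. *)
Lemma disjunctive_orbit_visits_target xi (a : X) V (l : nat) :
  disjunctive xi -> target_set T a -> nbhs a V ->
  exists2 m, (l <= m)%N & forall x, V (forward_comp T xi m x).
Proof.
move=> hxi [eta hyp cod] aV; have [n nV] := coding_image_sub_nbhs hyp cod aV.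
have [m lm hm] := disjunctive_forward_backward eta n l hxi.
by exists m => // x; have [p ->] := hm x.
Qed.

Lemma target_sub_closure_orbit xi (x : X) (l : nat) : disjunctive xi ->
  closure (target_set T) `<=`
    closure [set forward_comp T xi n x | n in [set n : nat | (l <= n)%N]].
Proof.
move=> hxi; rewrite (closure_id (closure [set _ | _ in _])).1; last exact: closed_closure.
apply: closureS => a ha V aV.
have [m lm mV] := disjunctive_orbit_visits_target l hxi ha aV.
by exists (forward_comp T xi m x); split => //; exists m.
Qed.

Lemma iter_barnsley_hutchinson_forward xi (x : X) V (m j : nat) :
  V (forward_comp T xi m x) ->
  iter j (barnsley_hutchinson T) V (forward_comp T xi (m + j) x).
Proof.
move=> mV; elim: j => [|j IH]; first by rewrite addn0.
rewrite addnS iterS; exists (xi (m + j).+1) => //.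
by exists (forward_comp T xi (m + j) x).
Qed.

Lemma stable_traps_disjunctive_orbit xi (x : X) V : disjunctive xi ->
  stable_BH_fixed_point T (closure (target_set T)) ->
  open V -> closure (target_set T) `<=` V ->
  \forall l \near \oo,
    [set forward_comp T xi n x | n in [set n : nat | (l <= n)%N]] `<=` V.
Proof.
move=> hxi [[K0 _ _] stab] oV KV; have [V0 [oV0 KV0 V0V]] := stab V oV KV.
have [a ha] : target_set T !=set0.
  by have [y yK] := K0; have [a []] := yK _ filterT; exists a.
have aV0 : nbhs a V0 by apply: open_nbhs_nbhs; split; last exact/KV0/subset_closure.
have [m _ mV0] := disjunctive_orbit_visits_target 0 hxi ha aV0.
exists m => // l /= ml _ [n /= ln <-]; apply: (V0V (n - m)%N).
by rewrite -{2}(subnKC (leq_trans ml ln)); exact: iter_barnsley_hutchinson_forward.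
Qed.

End orbits.

Section trapped_sequences_of_sets.
Context {R : realType} {X : metricType R}.
Variables (K : set X) (O : nat -> set X).
Hypothesis K_closure : forall l, K `<=` closure (O l).
Hypothesis trapped : forall V, open V -> K `<=` V -> \forall l \near \oo, O l `<=` V.

Lemma bigcap_closure_trapped : closed K ->
  K = \bigcap_(l in [set: nat]) closure (O l).
Proof.
move=> cK; apply/seteqP; split => [y Ky l _|y yO]; first exact: K_closure Ky.
apply: contrapT => nKy.
have : nbhs y (~` K) by apply: open_nbhs_nbhs; split => //; exact: closed_openC.
move=> /nbhs_ballP[e /= e0 eK].
have e20 : 0 < e / 2 by rewrite divr_gt0.
(* Halving the radius keeps [K] away from the closure of the ball at [y]. *)
have oV : open (~` closure (ball y (e / 2))) by exact/closed_openC/closed_closure.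
have KV : K `<=` ~` closure (ball y (e / 2)).
  move=> z Kz zy; have [w [yw zw]] := zy _ (nbhsx_ballx z _ e20).
  apply: (eK z) Kz; rewrite [e]splitr; apply: ball_triangle yw _.
  exact: ball_sym.
have [l hl] := filter_ex (trapped oV KV).
have [w [Ow yw]] := yO l I _ (nbhsx_ballx y _ e20).
by have /(_ (subset_closure yw)) := hl _ Ow.
Qed.

Lemma hausdorff_dist_cvg0 : K !=set0 ->
  hausdorff_dist (O l) K @[l --> \oo] --> 0%E.
Proof.
move=> [a0 Ka0] W W0.
have /nbhs_ballP[e /= e0 eW] : nbhs (0 : R^o) (fun r => W r%:E) by exact: W0.
have e20 : 0 < e / 2 by rewrite divr_gt0.
pose V := \bigcup_(a in K) interior (ball a (e / 2)).
have oV : open V by apply: bigcup_open => a _; exact: open_interior.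
have KV : K `<=` V by move=> a Ka; exists a => //; exact: nbhsx_ballx.
change (\forall l \near \oo, W (hausdorff_dist (O l) K)); near=> l.
have OV : O l `<=` V by near: l; exact: trapped.
have OK : (hausdorff_excess (O l) K <= (e / 2)%:E)%E.
  apply: ge_ereal_sup => _ [y /OV[a Ka /interior_subset ay] <-].
  apply: (@le_trans _ _ (mdist y a)%:E); first by apply: ereal_inf_lbound; exists a.
  by rewrite lee_fin metric_sym ltW //; move: ay; rewrite ballEmdist.
have KO : (hausdorff_excess K (O l) <= (e / 2)%:E)%E.
  apply: ge_ereal_sup => _ [a Ka <-].
  have [y [Oy ay]] := K_closure l Ka (nbhsx_ballx a _ e20).
  apply: (@le_trans _ _ (mdist a y)%:E); first by apply: ereal_inf_lbound; exists y.
  by rewrite lee_fin ltW //; move: ay; rewrite ballEmdist.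
(* The excess of an empty set is [-oo], so nonnegativity uses a point of [K]. *)
have ge0 : (0 <= hausdorff_dist (O l) K)%E.
  rewrite le_max; apply/orP; right.
  apply: (@le_trans _ _ (ereal_inf [set (mdist a0 b)%:E | b in O l])).
    by apply: le_ereal_inf_tmp => _ [b _ <-]; rewrite lee_fin mdist_ge0.
  by apply: ereal_sup_ubound; exists a0.
have le : (hausdorff_dist (O l) K <= (e / 2)%:E)%E by rewrite ge_max OK.
have fin : hausdorff_dist (O l) K \is a fin_num.
  by rewrite ge0_fin_numE // (le_lt_trans le) ?ltry.
rewrite /= -(fineK fin); apply: eW; rewrite /ball /= sub0r normrN.
rewrite -lte_fin -abse_EFin fineK // gee0_abs // (le_lt_trans le) //.
by rewrite lte_fin ltr_pdivrMr // ltr_pMr // ltr1n.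
Unshelve. all: by end_near.
Qed.

End trapped_sequences_of_sets.

Theorem theorem3 (R : realType) (X : metricType R) (hX : compact [set: X])
    (k : nat) (hk : (2 <= k)%N) (T : 'I_k -> X -> X)
    (hT : forall i, continuous (T i))
    (hA : stable_BH_fixed_point T (closure (target_set T)))
    (x : X) (xi : Sigma k) (hxi : disjunctive xi) :
  closure (target_set T) =
    \bigcap_(l in [set: nat])
      closure [set forward_comp T xi n x | n in [set n : nat | (l <= n)%N]] /\
  hausdorff_dist [set forward_comp T xi n x | n in [set n : nat | (l <= n)%N]]
    (closure (target_set T)) @[l --> \oo] --> 0%E.
Proof.
have cl l := @target_sub_closure_orbit _ _ _ T xi x l hxi.
have trap V := @stable_traps_disjunctive_orbit _ _ _ T xi x V hxi hA.
have [[K0 _ _] _] := hA.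
split; first exact: bigcap_closure_trapped cl trap (@closed_closure _ _).
exact: hausdorff_dist_cvg0 cl trap K0.
Qed.
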